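(* Let each $f_i:\mathbb{R}\to\mathbb{R}$, $i\in[N]$, be convex and differentiable with $|f_i'(s)-f_i'(t)|\le L_i|s-t|$ for all $s,t\in\mathbb{R}$, where $L_i>0$. Let $x^0\in S$ be such that $\mathcal{R}(x^0)<\infty$, and let $(x^k)_{k\ge 0}$ be the random sequence generated from $x^0$ by algorithm $RCD_\tau$ with probability distribution $(p_{\mathcal N})_{\mathcal N\in\mathcal P_\tau}$. Put $\phi_k=E[f(x^k)]$. Then for all $k\ge 1$ $$\phi_k-f^*\le \frac{2\,\mathcal{R}^2(x^0)}{k}.$$
   Context: Problem: $f^*=\min\{f(x): x\in S\}$, where $f(x)=\sum_{i=1}^N f_i(x_i)$ for $x\in\mathbb{R}^N$ and $S=\{x\in\mathbb{R}^N:\sum_{i=1}^N x_i=0\}$. The set $X^*\subseteq S$ of optimal solutions is assumed nonempty. $[N]=\{1,\dots,N\}$. Graph: $\mathcal G=([N],E)$ is a connected undirected graph, $2\le\tau\le N$ is an integer, and $\mathcal P_\tau$ is the set of paths of $\tau$ (distinct) vertices in $\mathcal G$; each path $\mathcal N$ is used only through its set of $\tau$ vertices. $(p_{\mathcal N})_{\mathcal N\in\mathcal P_\tau}$ is a given probability distribution on $\mathcal P_\tau$. Algorithm $RCD_\tau$: start from $x^0\in S$. At iteration $k\ge0$, draw $\mathcal N_k\in\mathcal P_\tau$ (independently of the past) with $\Pr(\mathcal N_k=\mathcal N)=p_{\mathcal N}$; set $x_i^{k+1}=x_i^k$ for $i\notin\mathcal N_k$ and $x_i^{k+1}=x_i^k+d_i^k$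 for $i\in\mathcal N_k$, where $$d_i^k=\frac1{L_i}\,\frac{\sum_{j\in\mathcal N_k}\frac1{L_j}\left(f_j'(x_j^k)-f_i'(x_i^k)\right)}{\sum_{j\in\mathcal N_k}\frac1{L_j}}.$$ Matrix $G_\tau$: for $\mathcal N\in\mathcal P_\tau$ let $\ell_{\mathcal N}\in\mathbb{R}^N$ have entries $1/L_i$ for $i\in\mathcal N$ and $0$ otherwise, and let $G_{\mathcal N}=\mathrm{diag}(\ell_{\mathcal N})-\frac{1}{\sum_{i\in\mathcal N}1/L_i}\,\ell_{\mathcal N}\ell_{\mathcal N}^T$. Put $G_\tau=\sum_{\mathcal N\in\mathcal P_\tau}p_{\mathcal N}G_{\mathcal N}$. This matrix is positive semidefinite with $G_\tau e=0$, where $e$ is the all-ones vector. Standing assumption: the eigenvalue $0$ of $G_\tau$ is simple, i.e. its second smallest eigenvalue is positive. Norms: $\|u\|_{G_\tau}=\sqrt{u^TG_\tau u}$ for $u\in\mathbb{R}^N$, and $\|x\|^*_{G_\tau}=\max\{\langle x,u\rangle: u\in\mathbb{R}^N,\ \|u\|_{G_\tau}\le1\}$ for $x\in S$. Level-set size: $\mathcal R(x^0)=\max_{x\in S,\ f(x)\le f(x^0)}\ \min_{x^*\in X^*}\|x-x^*\|^*_{G_\tau}$ (max understood as supremum). *)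

(* Defs.v *)
From HB Require Import structures.
From mathcomp Require Import all_boot all_order all_algebra.
From mathcomp Require Import all_classical all_reals all_analysis.
Import Order.TTheory GRing.Theory Num.Theory.
Import numFieldNormedType.Exports.

Set Implicit Arguments.
Unset Strict Implicit.
Unset Printing Implicit Defensive.

Local Open Scope classical_set_scope.
Local Open Scope ring_scope.

(* The vertex set [N] = {1, ..., N} is represented by 'I_N, and vectors of R^N
   by column vectors. *)

Definition undirected_graph (N : nat) (e : rel 'I_N) : Prop :=
  symmetric e /\ irreflexive e.

Definition connected_graph (N : nat) (e : rel 'I_N) : Prop :=
  forall i j : 'I_N, connect e i j.

(* A path is given with an orientation, so that an unoriented path appears here
   once for each of its two orientations. Distributions on paths are arbitrary
   and may put all the mass of a path on one orientation. *)
Definition gpath (N tau : nat) (e : rel 'I_N) : finType :=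
  {t : tau.-tuple 'I_N | uniq t && sorted e t}.

Definition vertices (N tau : nat) (e : rel 'I_N) (t : gpath tau e) :
    {set 'I_N} :=
  [set i in val t].

Definition distribution_on (R : realType) (I : finType) (p : I -> R) : Prop :=
  (forall t, 0 <= p t) /\ \sum_t p t = 1.

Section Problem.
Variables (R : realType) (N : nat) (f : 'I_N -> R -> R).

Definition objective (x : 'cV[R]_N) : R := \sum_i f i (x i 0).

Definition feasible : set 'cV[R]_N := [set x | \sum_i x i 0 = 0].

Definition optimal : set 'cV[R]_N :=
  [set x | feasible x /\ forall y, feasible y -> objective x <= objective y].

Definition optimal_value : R := inf (objective @` feasible).

End Problem.

Arguments feasible {R N}.

Section Algorithm.
Variables (R : realType) (N : nat) (f : 'I_N -> R -> R) (L : 'I_N -> R).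

Definition rcd_direction (A : {set 'I_N}) (x : 'cV[R]_N) (i : 'I_N) : R :=
  (L i)^-1 *
  ((\sum_(j in A) (L j)^-1 * (derive1 (f j) (x j 0) - derive1 (f i) (x i 0)))
    / \sum_(j in A) (L j)^-1).

Definition rcd_step (A : {set 'I_N}) (x : 'cV[R]_N) : 'cV[R]_N :=
  \col_i (if i \in A then x i 0 + rcd_direction A x i else x i 0).

Fixpoint rcd_iterate (A : nat -> {set 'I_N}) (x0 : 'cV[R]_N) (k : nat) :
    'cV[R]_N :=
  if k is k'.+1 then rcd_step (A k') (rcd_iterate A x0 k') else x0.

End Algorithm.

(* The draws are measurable for the discrete sigma-algebra on paths, have law
   p, and each draw is independent of the vector of all the previous ones. *)
Definition independent_draws (R : realType) (I : finType) (p : I -> R)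
    (d : measure_display) (T : measurableType d) (P : probability T R)
    (draw : nat -> T -> I) : Prop :=
  [/\ forall k (A : set I), measurable (draw k @^-1` A),
      forall k (t : I), P [set w | draw k w = t] = (p t)%:E
    & forall k (A : set I) (B : set (k.-tuple I)),
        let past w := [tuple draw i w | i < k] in
        P (draw k @^-1` A `&` past @^-1` B) =
        (P (draw k @^-1` A) * P (past @^-1` B))%E].

Section GMatrix.
Variables (R : realType) (N : nat) (L : 'I_N -> R).

Definition ell (A : {set 'I_N}) : 'cV[R]_N :=
  \col_i (if i \in A then (L i)^-1 else 0).

Definition G_of_set (A : {set 'I_N}) : 'M[R]_N :=
  diag_mx (ell A)^T - (\sum_(i in A) (L i)^-1)^-1 *: (ell A *m (ell A)^T).

Definition G_matrix (tau : nat) (e : rel 'I_N) (p : gpath tau e -> R) :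
    'M[R]_N :=
  \sum_(t : gpath tau e) p t *: G_of_set (vertices t).

End GMatrix.

(* Simple means of algebraic multiplicity one. *)
Definition simple_eigenvalue (R : realType) (N : nat) (G : 'M[R]_N) (a : R) :
    Prop :=
  mup a (char_poly G) = 1%N.

Section Norms.
Variables (R : realType) (N : nat) (G : 'M[R]_N).

Definition G_norm (u : 'cV[R]_N) : R := Num.sqrt ((u^T *m G *m u) 0 0).

(* Suprema and infima are taken in the extended reals, so that no default value
   is involved when a set is unbounded. *)
Definition dual_norm (x : 'cV[R]_N) : \bar R :=
  ereal_sup [set ((x^T *m u) 0 0)%:E | u in [set u | G_norm u <= 1]].

Definition level_set_size (f : 'I_N -> R -> R) (x0 : 'cV[R]_N) : \bar R :=
  ereal_sup
    [set ereal_inf [set dual_norm (x - y) | y in optimal f]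
      | x in [set x | feasible x /\ objective f x <= objective f x0]].

End Norms.

(* Main.v *)
(* With [g] the gradient, a step along [A] is [x - G_A g], and the Lipschitz bound
   on [f'] gives [f (x - G_A g) <= f x - g^T G_A g / 2]; averaging over the draw,
   the expected decrease is at least [||g||^2 / 2] in the seminorm of [G_tau].
   Convexity and duality give [f x - f* <= R ||g||] on the level set of [x0],
   which the iterates never leave. Hence the expected gaps [D k] satisfy
   [D k ^ 2 <= 2 R^2 (D k - D (k+1))], and so [k D k <= 2 R^2]. All expectations
   are finite sums over the tuples of past draws. *)
Require Import Defs.
From HB Require Import structures.
From mathcomp Require Import all_boot all_order all_algebra.
From mathcomp Require Import all_classical all_reals all_analysis.
From mathcomp Require Import ring lra.
Import Order.TTheory GRing.Theory Num.Theory.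
Import numFieldNormedType.Exports.

Set Implicit Arguments.
Unset Strict Implicit.
Unset Printing Implicit Defensive.

Local Open Scope classical_set_scope.
Local Open Scope ring_scope.

(** * One-variable tangent and descent inequalities *)

(** By the mean value theorem the chord slope is the derivative at an intermediate point, which
    monotonicity compares with the one at [x]. *)
Lemma nondecreasing_derive1_tangent (R : realType) (f : R -> R) (x y : R) :
  (forall s : R, derivable f s 1) ->
  (forall s t : R, s <= t -> derive1 f s <= derive1 f t) ->
  f x + derive1 f x * (y - x) <= f y.
Proof.
move=> df ndf.
have is_df (s : R) : is_derive s 1 f (derive1 f s).
  by rewrite derive1E; exact: derivableP.
have cf (a b : R) : {within `[a, b], continuous f}.
  by apply: derivable_within_continuous => s _; exact: df.
have [xy|yx] := leP x y.
  have [c] := MVT_segment xy (fun s _ => is_df s) (cf x y).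
  rewrite in_itv/= => /andP[xc _] fE.
  have := ler_wpM2r (_ : 0 <= y - x) (ndf _ _ xc); rewrite subr_ge0 => /(_ xy).
  by lra.
have [c] := MVT_segment (ltW yx) (fun s _ => is_df s) (cf y x).
rewrite in_itv/= => /andP[_ cx] fE.
have := ler_wpM2r (_ : 0 <= x - y) (ndf _ _ cx).
by rewrite subr_ge0 => /(_ (ltW yx)); lra.
Qed.

(** The Lipschitz bound makes the derivative of [L / 2 * s ^+ 2 - f s] nondecreasing, so this
    function lies above its tangent at [x]; rearranging gives the claim. *)
Lemma lipschitz_derive1_descent (R : realType) (f : R -> R) (L x h : R) :
  (forall s : R, derivable f s 1) ->
  (forall s t : R, `|derive1 f s - derive1 f t| <= L * `|s - t|) ->
  f (x + h) <= f x + derive1 f x * h + L / 2 * h ^+ 2.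
Proof.
move=> df lf.
pose g (s : R) := L / 2 * s ^+ 2 - f s.
have dg (s : R) : is_derive s 1 g (L * s - derive1 f s).
  have ? : is_derive s 1 f (derive1 f s).
    by rewrite derive1E; exact: derivableP.
  apply: is_derive_eq; rewrite /GRing.scale/=; lra.
have g'E (s : R) : derive1 g s = L * s - derive1 f s.
  by rewrite derive1E derive_val.
have := @nondecreasing_derive1_tangent R g x (x + h).
rewrite g'E /g => /(_ (fun s => @ex_derive _ _ _ _ _ _ _ (dg s))) H.
suff : forall s t : R, s <= t -> derive1 g s <= derive1 g t by move/H; lra.
move=> s t st; rewrite !g'E.
have := le_trans (ler_norm _) (lf t s).
by rewrite ger0_norm ?subr_ge0//; lra.
Qed.

(** For steps [0 < h < 1] convexity bounds the difference quotient at [x] along [y - x] by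
    [f y - f x]; let [h] tend to 0 from the right. *)
Lemma convex_function_tangent (R : realType) (f : R -> R) (x y : R) :
  convex_function [set: R^o] f -> derivable f x 1 ->
  f x + derive1 f x * (y - x) <= f y.
Proof.
move=> cf df.
have dfx : differentiable f x by apply/derivable1_diffP.
have dfv : derivable f x (y - x) by exact: diff_derivable.
have -> : derive1 f x * (y - x) = 'D_(y - x) f x.
  by rewrite deriveE// deriv1E// mulrC.
rewrite addrC -lerBrDr.
apply: (cvgr_to_le (cvg_dnbhs_at_right dfv)).
near=> h.
have h0 : 0 < h by near: h; exact: nbhs_right_gt.
have h1 : h < 1 by near: h; exact: nbhs_right_lt.
have cfh : f (h * y + (1 - h) * x) <= h * f y + (1 - h) * f x :=
  cf (Itv01 (ltW h0) (ltW h1)) y x (in_setT _) (in_setT _).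
rewrite /= /GRing.scale/= ler_pdivrMl//.
have -> : h * (y - x) + x = h * y + (1 - h) * x by ring.
by lra.
Unshelve. all: by end_near.
Qed.

(** * The quadratic form of [G] and the effect of one step *)

Definition gradient (R : realType) (N : nat) (f : 'I_N -> R -> R)
    (x : 'cV[R]_N) : 'cV[R]_N := \col_i derive1 (f i) (x i 0).

(** Up to the total weight, this is the variance of [u] on [A] for the weights [(L i)^-1]. *)
Lemma G_of_set_quadratic (R : realType) (N : nat) (L : 'I_N -> R)
    (A : {set 'I_N}) (u : 'cV[R]_N) :
  (u^T *m G_of_set L A *m u) 0 0 =
  \sum_(i in A) (L i)^-1 * u i 0 ^+ 2
  - (\sum_(i in A) (L i)^-1)^-1 * (\sum_(i in A) (L i)^-1 * u i 0) ^+ 2.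
Proof.
have ellE : ((ell L A)^T *m u) 0 0 = \sum_(i in A) (L i)^-1 * u i 0.
  rewrite mxE [RHS]big_mkcond/=; apply: eq_bigr => i _; rewrite !mxE.
  by case: ifP; rewrite ?mul0r.
rewrite /G_of_set mulmxBr mulmxBl -scalemxAr -scalemxAl mulmxA -mulmxA.
rewrite -[X in _ - _ *: X]mulmxA.
rewrite [u^T *m ell L A](_ : _ = ((ell L A)^T *m u)^T); last first.
  by rewrite trmx_mul trmxK.
rewrite !mxE; congr (_ - _ * _).
  rewrite [RHS]big_mkcond/=; apply: eq_bigr => i _.
  rewrite mul_diag_mx !mxE; case: ifP => _; last by rewrite mul0r mulr0.
  by rewrite mulrCA -expr2.
by rewrite big_ord1 mxE ellE expr2.
Qed.

Lemma sumr_inv_neq0 (R : realType) (N : nat) (L : 'I_N -> R) (A : {set 'I_N})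
    (i0 : 'I_N) :
  (forall i, 0 < L i) -> i0 \in A -> \sum_(i in A) (L i)^-1 != 0.
Proof.
move=> L0 i0A; rewrite gt_eqF// (bigD1 i0)//= ltr_pwDl ?invr_gt0//.
by apply: sumr_ge0 => i _; rewrite invr_ge0 ltW.
Qed.

Lemma rcd_step_descent (R : realType) (N : nat) (f : 'I_N -> R -> R)
    (L : 'I_N -> R) (A : {set 'I_N}) (x : 'cV[R]_N) :
  (forall i, 0 < L i) ->
  (forall i (h : R), f i (x i 0 + h) <=
     f i (x i 0) + derive1 (f i) (x i 0) * h + L i / 2 * h ^+ 2) ->
  objective f (rcd_step f L A x) <= objective f x
    - 2^-1 * ((gradient f x)^T *m G_of_set L A *m gradient f x) 0 0.
Proof.
move=> L0 desc; rewrite G_of_set_quadratic.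
set S := \sum_(i in A) (L i)^-1.
under eq_bigr do rewrite mxE.
set M := (X in X ^+ 2).
pose g i := derive1 (f i) (x i 0).
pose D := rcd_direction f L A x.
have gE i : gradient f x i 0 = g i by rewrite mxE.
have ME : M = \sum_(i in A) (L i)^-1 * g i by apply: eq_bigr => i _; rewrite gE.
apply: (@le_trans _ _ (\sum_i (f i (x i 0) +
    if i \in A then g i * D i + L i / 2 * D i ^+ 2 else 0))).
  apply: ler_sum => i _; rewrite mxE; case: ifP => _; last by rewrite addr0.
  by rewrite addrA; exact: desc.
rewrite big_split/= lerD2l -big_mkcond/=.
(* For empty [A] no coordinate moves and all sums are empty; otherwise [S] can be divided by. *)
have [A0|[i0 i0A]] := set_0Vmem A.
  by rewrite /M A0 !big_set0 expr0n/= mulr0 subrr mulr0 oppr0.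
have S0 : S != 0 by exact: sumr_inv_neq0 i0A.
(* With the weighted mean [m = M / S] of the gradient, [D i = (m - g i) / L i], and the left side
   factors as [(m - g i) * (m + g i) / (2 * L i)]. *)
have termE i : g i * D i + L i / 2 * D i ^+ 2 =
    2^-1 * (M / S) ^+ 2 * (L i)^-1 - 2^-1 * ((L i)^-1 * g i ^+ 2).
  have -> : D i = (L i)^-1 * (M / S - g i).
    rewrite /D /rcd_direction -/S; congr (_ * _).
    under eq_bigr do rewrite mulrBr.
    rewrite sumrB -mulr_suml -/S -ME -/(g i) mulrBl; congr (_ - _).
    by rewrite mulrAC mulfV// mul1r.
  by field; rewrite S0 gt_eqF.
rewrite (eq_bigr _ (fun i _ => termE i)) sumrB -!mulr_sumr -/S.
by rewrite /g le_eqVlt; apply/orP; left; apply/eqP; field.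
Qed.

(** The total displacement is a multiple of a double sum over [A] that is antisymmetric in its two
    indices, hence zero. *)
Lemma rcd_step_feasible (R : realType) (N : nat) (f : 'I_N -> R -> R)
    (L : 'I_N -> R) (A : {set 'I_N}) (x : 'cV[R]_N) :
  feasible x -> feasible (rcd_step f L A x).
Proof.
rewrite /feasible/= => fx; pose D := rcd_direction f L A x.
under eq_bigr do rewrite mxE.
rewrite (eq_bigr (fun i => x i 0 + if i \in A then D i else 0)); last first.
  by move=> i _; case: ifP; rewrite ?addr0.
rewrite big_split/= fx add0r -big_mkcond/=.
set S := \sum_(i in A) (L i)^-1; pose g i := derive1 (f i) (x i 0).
rewrite (eq_bigr (fun i => S^-1 * \sum_(j in A) ((L i)^-1 * ((L j)^-1 * g j)
   - (L j)^-1 * ((L i)^-1 * g i)))); last first.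
  move=> i _; rewrite /D /rcd_direction -/S mulrA mulrC mulr_sumr.
  congr (_ * _).
  by apply: eq_bigr => j _; rewrite /g; ring.
rewrite -mulr_sumr; under eq_bigr do rewrite sumrB.
by rewrite sumrB [X in _ - X]exchange_big/= subrr mulr0.
Qed.

(** Centering at the weighted mean [M / S] turns the form into a weighted sum of squares. *)
Lemma G_of_set_ge0 (R : realType) (N : nat) (L : 'I_N -> R)
    (A : {set 'I_N}) (u : 'cV[R]_N) :
  (forall i, 0 < L i) -> 0 <= (u^T *m G_of_set L A *m u) 0 0.
Proof.
move=> L0; rewrite G_of_set_quadratic.
set S := \sum_(i in A) (L i)^-1; set M := \sum_(i in A) _ * u i 0.
have [A0|[i0 i0A]] := set_0Vmem A.
  by rewrite /M A0 !big_set0 expr0n/= mulr0 subrr.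
have S0 : S != 0 by exact: sumr_inv_neq0 i0A.
rewrite [leRHS](_ : _ = \sum_(i in A) (L i)^-1 * (u i 0 - M / S) ^+ 2).
  by apply: sumr_ge0 => i _; rewrite mulr_ge0 ?sqr_ge0// invr_ge0 ltW.
transitivity (\sum_(i in A) ((L i)^-1 * u i 0 ^+ 2
    - 2 * (M / S) * ((L i)^-1 * u i 0) + (M / S) ^+ 2 * (L i)^-1)).
  by rewrite big_split/= sumrB -!mulr_sumr -/S -/M; field.
by apply: eq_bigr => i _; ring.
Qed.

Lemma G_matrix_quadratic (R : realType) (N tau : nat) (e : rel 'I_N)
    (L : 'I_N -> R) (p : gpath tau e -> R) (u : 'cV[R]_N) :
  (u^T *m G_matrix L p *m u) 0 0 =
  \sum_t p t * (u^T *m G_of_set L (vertices t) *m u) 0 0.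
Proof.
rewrite /G_matrix mulmx_sumr mulmx_suml summxE; apply: eq_bigr => t _.
by rewrite -scalemxAr -scalemxAl mxE.
Qed.

(** * Duality and the optimality gap *)

Lemma G_normZ (R : realType) (N : nat) (G : 'M[R]_N) (a : R) (u : 'cV[R]_N) :
  G_norm G (a *: u) = `|a| * G_norm G u.
Proof.
rewrite /G_norm -scalemxAr [(a *: u)^T]linearZ/= -!scalemxAl scalerA mxE -expr2.
by rewrite sqrtrM ?sqr_ge0// sqrtr_sqr.
Qed.

Lemma dual_norm_ge0 (R : realType) (N : nat) (G : 'M[R]_N) (x : 'cV[R]_N) :
  (0 <= dual_norm G x)%E.
Proof.
apply: ereal_sup_ubound; exists 0; last by rewrite mulmx0 mxE.
by rewrite /= /G_norm mulmx0 mxE sqrtr0.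
Qed.

(** Rescale [u] into the unit ball; vectors of zero seminorm need a separate argument. *)
Lemma dual_norm_pairing (R : realType) (N : nat) (G : 'M[R]_N)
    (x u : 'cV[R]_N) (r : R) :
  (dual_norm G x <= r%:E)%E -> (x^T *m u) 0 0 <= r * G_norm G u.
Proof.
move=> xr; set a := (x^T *m u) 0 0.
have bound t : `|t| * G_norm G u <= 1 -> t * a <= r.
  move=> tu; rewrite -lee_fin; apply: le_trans xr.
  apply: ereal_sup_ubound; exists (t *: u); first by rewrite /= G_normZ.
  by rewrite -scalemxAr mxE.
have := sqrtr_ge0 ((u^T *m G *m u) 0 0); rewrite -/(G_norm G u).
rewrite le_eqVlt => /predU1P[u0|u_gt0].
  (* Multiples of [u] stay in the unit ball, so [a > 0] would make the
     supremum infinite. *)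
  rewrite -u0 mulr0 leNgt; apply/negP => a_gt0.
  have := bound ((r + 1) / a); rewrite -u0 mulr0 ler01 => /(_ isT).
  by rewrite divfK ?gt_eqF// gerDl ler10.
have := bound (G_norm G u)^-1.
rewrite normfV gtr0_norm// mulVf ?gt_eqF// lexx => /(_ isT).
by rewrite mulrC ler_pdivrMr.
Qed.

Lemma optimality_gap_le (R : realType) (N : nat) (G : 'M[R]_N)
    (f : 'I_N -> R -> R) (x0 x : 'cV[R]_N) (fstar r : R) :
  (forall i (s t : R), f i s + derive1 (f i) s * (t - s) <= f i t) ->
  (forall y, optimal f y -> objective f y = fstar) ->
  level_set_size G f x0 = r%:E ->
  feasible x -> objective f x <= objective f x0 ->
  objective f x - fstar <= r * G_norm G (gradient f x).
Proof.
move=> tan fstarE sizeE fx xx0.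
set n := G_norm G _.
have n_ge0 : 0 <= n by exact: sqrtr_ge0.
apply/ler_addgt0Pr => eps eps_gt0.
(* The infimum over optimal points need not be attained, so [y] is only optimal up to [d], chosen so
   that [d * n <= eps] even when [n = 0]. *)
pose d := eps / (n + 1).
have n1_gt0 : 0 < n + 1 by rewrite ltr_wpDl.
have d_gt0 : 0 < d by rewrite divr_gt0.
have : (ereal_inf [set dual_norm G (x - y) | y in optimal f] < (r + d)%:E)%E.
  apply: (@le_lt_trans _ _ r%:E); last by rewrite lte_fin ltrDl.
  by rewrite -sizeE; apply: ereal_sup_ubound; exists x.
move=> /ereal_inf_lt[_ [y yopt <-]] /ltW xy.
have {xy} := dual_norm_pairing (gradient f x) xy.
have : objective f x - fstar <= ((x - y)^T *m gradient f x) 0 0.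
  rewrite -(fstarE _ yopt) /objective -sumrB mxE; apply: ler_sum => i _.
  by rewrite !mxE; have := tan i (x i 0) (y i 0); lra.
have : d * n <= eps.
  by rewrite /d mulrAC ler_pdivrMr// ler_pM2l// lerDl.
by rewrite -/n; lra.
Qed.

(** * The scalar recursion *)

Lemma quadratic_decrease_rate (R : realFieldType) (c : R) (D : nat -> R) :
  0 <= c -> (forall k, 0 <= D k) ->
  (forall k, D k ^+ 2 <= c * (D k - D k.+1)) ->
  forall k, k%:R * D k <= c.
Proof.
move=> c_ge0 D_ge0 Ddec; elim=> [|k IH]; first by rewrite mul0r.
have [c0|c_neq0] := eqVneq c 0.
  have := Ddec k.+1; rewrite c0 mul0r => D0.
  by rewrite (_ : D k.+1 = 0) ?mulr0//; nra.
have c_gt0 : 0 < c by rewrite lt_def c_neq0.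
have yz := Ddec k; have y0 := D_ge0 k; have z0 := D_ge0 k.+1.
move: (D k) (D k.+1) => y z in IH yz y0 z0 *.
have cy : 0 < c + y by rewrite ltr_wpDr.
(* This is [1 / z >= 1 / y + 1 / c] cleared of denominators, since [y] and [z] may vanish. *)
have czy : (c + y) * z <= c * y by nra.
have kyc : (k%:R + 1) * y <= c + y by lra.
rewrite -natr1 -(ler_pM2l cy) mulrCA.
have k1 : 0 <= k%:R + 1 :> R by rewrite addr_ge0.
apply: le_trans (ler_wpM2l k1 czy) _.
by rewrite mulrCA [leRHS]mulrC ler_pM2l.
Qed.

(** * Expectations as finite sums over draws *)

Lemma expectation_finite (R : realType) (d : measure_display)
    (T : measurableType d) (P : probability T R) (J : finType) (Y : T -> J)
    (F : J -> R) :
  (forall j, measurable (Y @^-1` [set j])) ->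
  ('E_P[fun w => F (Y w)] = (\sum_j fine (P (Y @^-1` [set j])) * F j)%:E)%E.
Proof.
move=> mY; rewrite unlock.
under eq_integral => w _.
  have -> : F (Y w) = \sum_j F j * \1_(Y @^-1` [set j]) w.
    rewrite (bigD1 (Y w))//= indicE mem_set// mulr1 big1 ?addr0// => j jY.
    by rewrite indicE memNset ?mulr0// => /= /esym /eqP; rewrite (negbTE jY).
  rewrite -sumEFin.
  over.
rewrite integral_sum//; last first.
  move=> j; under eq_fun do rewrite EFinM.
  by apply: integrableZl => //; exact: integrable_indic.
rewrite -sumEFin; apply: eq_bigr => j _.
under eq_integral do rewrite EFinM.
rewrite integralZl//; last exact: integrable_indic.
rewrite integral_indic// setIT muleC EFinM fineK//.
exact: fin_num_measure.
Qed.

(** The same tuple as the local [past] of [independent_draws]. *)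
Definition past (T I : Type) (draw : nat -> T -> I) (k : nat) (w : T) :
    k.-tuple I :=
  [tuple draw i w | i < k].

Lemma pastE (T I : Type) (draw : nat -> T -> I) (k : nat) (w : T) :
  past draw k w = mkseq (draw ^~ w) k :> seq I.
Proof. by rewrite /mkseq -val_enum_ord -map_comp. Qed.

Lemma pastS (T I : Type) (draw : nat -> T -> I) (k : nat) (w : T) :
  past draw k.+1 w = rcons (past draw k w) (draw k w) :> seq I.
Proof. by rewrite !pastE mkseqS. Qed.

Section Draws.
Variables (R : realType) (I : finType) (p : I -> R) (d : measure_display).
Variables (T : measurableType d) (P : probability T R) (draw : nat -> T -> I).

Lemma measurable_past (draws : independent_draws p P draw) (k : nat)
    (t : k.-tuple I) :
  measurable (past draw k @^-1` [set t]).
Proof.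
have [mdraw _ _] := draws.
rewrite (_ : _ @^-1` _ =
    \bigcap_(i in [set: 'I_k]) draw i @^-1` [set tnth t i]).
  by apply: fin_bigcap_measurable => // i _; exact: mdraw.
apply/seteqP; split=> w /=; first by move=> <- i _; rewrite tnth_mktuple.
by move=> H; apply: eq_from_tnth => i; rewrite tnth_mktuple; exact: H.
Qed.

Definition past_law (k : nat) (t : k.-tuple I) : R :=
  fine (P (past draw k @^-1` [set t])).

Lemma past_law_ge0 (k : nat) (t : k.-tuple I) : 0 <= past_law t.
Proof. exact: fine_ge0. Qed.

Lemma expectation_past (draws : independent_draws p P draw) (k : nat)
    (F : k.-tuple I -> R) :
  ('E_P[fun w => F (past draw k w)] = (\sum_t past_law t * F t)%:E)%E.
Proof. by rewrite expectation_finite//; exact: measurable_past. Qed.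

Lemma sum_past_law (draws : independent_draws p P draw) (k : nat) :
  \sum_t @past_law k t = 1.
Proof.
have := expectation_past draws (fun _ : k.-tuple I => 1 : R).
rewrite (expectation_cst P 1) => -[->].
by apply: eq_bigr => t _; rewrite mulr1.
Qed.

(** Independence makes the joint law of past and next draw a product; the inner sum is the
    conditional expectation given the past. *)
Lemma expectation_past_draw (draws : independent_draws p P draw)
    (k : nat) (F : k.-tuple I -> I -> R) :
  ('E_P[fun w => F (past draw k w) (draw k w)] =
   (\sum_t past_law t * \sum_i p i * F t i)%:E)%E.
Proof.
have [mdraw law_draw indep] := draws.
have preimE (j : k.-tuple I * I) :
    (fun w => (past draw k w, draw k w)) @^-1` [set j] =
    draw k @^-1` [set j.2] `&` past draw k @^-1` [set j.1].
  apply/seteqP; split=> w /=; first by move=> <-.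
  by case: j => ? ? /= [<- <-].
rewrite (expectation_finite P (Y := fun w => (past draw k w, draw k w))
  (fun j => F j.1 j.2)).
  congr (_%:E); under [RHS]eq_bigr do rewrite mulr_sumr.
  rewrite pair_big/=; apply: eq_bigr => -[t i] _.
  rewrite preimE/= indep fineM//; last 2 first.
  - by apply: fin_num_measure; exact: mdraw.
  - by apply: fin_num_measure; exact: measurable_past.
  by rewrite [P (draw k @^-1` _)]law_draw/= mulrA [p i * _]mulrC.
move=> j; rewrite preimE; apply: measurableI; first exact: mdraw.
exact: measurable_past.
Qed.

End Draws.

(** * Iterates as functions of the past draws, and the rate *)

(** Taking a sequence rather than a tuple lets [rcons] append a draw without length casts. *)
Definition rcd_fold (R : realType) (N tau : nat) (e : rel 'I_N)
    (f : 'I_N -> R -> R) (L : 'I_N -> R) (x0 : 'cV[R]_N)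
    (s : seq (gpath tau e)) : 'cV[R]_N :=
  foldl (fun x t => rcd_step f L (vertices t) x) x0 s.

Lemma rcd_iterate_past (R : realType) (N tau : nat) (e : rel 'I_N)
    (f : 'I_N -> R -> R) (L : 'I_N -> R) (x0 : 'cV[R]_N) (T : Type)
    (draw : nat -> T -> gpath tau e) (k : nat) (w : T) :
  rcd_iterate f L (fun j => vertices (draw j w)) x0 k =
  rcd_fold f L x0 (past draw k w).
Proof.
elim: k => [|k IHk] /=; first by rewrite pastE.
by rewrite pastS /rcd_fold foldl_rcons IHk.
Qed.

Theorem theorem3p1 (R : realType) (N tau : nat) (e : rel 'I_N)
    (f : 'I_N -> R -> R) (L : 'I_N -> R) (p : gpath tau e -> R)
    (x0 : 'cV[R]_N)
    (d : measure_display) (T : measurableType d) (P : probability T R)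
    (draw : nat -> T -> gpath tau e)
    (graph_e : undirected_graph e) (conn_e : connected_graph e)
    (tau_bounds : (2 <= tau <= N)%N)
    (distr_p : distribution_on p)
    (simple0 : simple_eigenvalue (G_matrix L p) 0)
    (optimal_n0 : optimal f !=set0)
    (L_gt0 : forall i, 0 < L i)
    (convex_f : forall i, convex_function [set: R^o] (f i))
    (derivable_f : forall i (s : R), derivable (f i) s 1)
    (lipschitz_f' : forall i (s t : R),
       `|derive1 (f i) s - derive1 (f i) t| <= L i * `|s - t|)
    (x0_feasible : feasible x0)
    (finite_size : (level_set_size (G_matrix L p) f x0 < +oo)%E)
    (draws : independent_draws p P draw) :
  forall k : nat, (1 <= k)%N ->
    let x w := rcd_iterate f L (fun j => vertices (draw j w)) x0 k in
    ('E_P[fun w => objective f (x w)] - (optimal_value f)%:E <=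
     2%:E * level_set_size (G_matrix L p) f x0 ^+ 2 * (k%:R^-1)%:E)%E.
Proof.
move=> k k_gt0; cbv zeta.
have [p_ge0 p_sum1] := distr_p.
have [xstar xstar_opt] := optimal_n0.
(* An optimal point makes the set of values nonempty and bounded below, so [inf] is a true minimum
   here and not a default value. *)
have optE y : optimal f y -> objective f y = optimal_value f.
  move=> [fy ymin]; apply/eqP; rewrite eq_le; apply/andP; split.
    apply: lb_le_inf; first by exists (objective f y), y.
    by move=> _ [z fz <-]; exact: ymin.
  apply: ge_inf; last by exists y.
  by exists (objective f y) => _ [z fz <-]; exact: ymin.
have min_le y : feasible y -> optimal_value f <= objective f y.
  by rewrite -(optE _ xstar_opt); apply: xstar_opt.2.
have size_ge0 : (0 <= level_set_size (G_matrix L p) f x0)%E.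
  apply: (@le_trans _ _ (ereal_inf
      [set dual_norm (G_matrix L p) (x0 - y) | y in optimal f])).
    by apply/ereal_infP => _ [y _ <-]; exact: dual_norm_ge0.
  by apply: ereal_sup_ubound; exists x0.
have [r sizeE] : exists r : R, level_set_size (G_matrix L p) f x0 = r%:E.
  exists (fine (level_set_size (G_matrix L p) f x0)).
  by rewrite fineK// ge0_fin_numE.
have r_ge0 : 0 <= r by rewrite -lee_fin -sizeE.
have quad_ge0 A (u : 'cV[R]_N) := G_of_set_ge0 A u L_gt0.
have descent A y := @rcd_step_descent R N f L A y L_gt0
  (fun i h =>
     lipschitz_derive1_descent (y i 0) h (derivable_f i) (lipschitz_f' i)).
pose X (s : seq (gpath tau e)) := rcd_fold f L x0 s.
have XS s t : X (rcons s t) = rcd_step f L (vertices t) (X s).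
  by rewrite /X /rcd_fold foldl_rcons.
have X_ok s : feasible (X s) /\ objective f (X s) <= objective f x0.
  elim/last_ind: s => [|s t [IHf IHo]]; first by [].
  rewrite XS; split; first exact: rcd_step_feasible.
  apply: le_trans (descent _ _) _; apply: le_trans IHo.
  by rewrite gerBl mulr_ge0.
pose gap s := objective f (X s) - optimal_value f.
(* The recursion conditional on the draws [s]: the sum is the expected gap after one more draw. *)
have gap_sq s : gap s ^+ 2 <= 2 * r ^+ 2 *
    (gap s - \sum_t p t * gap (rcons s t)).
  have [fX oX] := X_ok s; set g := gradient f (X s).
  have := optimality_gap_le
    (fun i a b => convex_function_tangent b (convex_f i) (derivable_f i a))
    optE sizeE fX oX.
  rewrite -/(gap s) -/g => gap_le.
  have gap_ge0 : 0 <= gap s by rewrite subr_ge0 min_le.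
  have quadG : G_norm (G_matrix L p) g ^+ 2 =
      \sum_t p t * (g^T *m G_of_set L (vertices t) *m g) 0 0.
    rewrite -G_matrix_quadratic sqr_sqrtr// G_matrix_quadratic.
    by apply: sumr_ge0 => t _; rewrite mulr_ge0.
  have drop : G_norm (G_matrix L p) g ^+ 2 <=
      2 * (gap s - \sum_t p t * gap (rcons s t)).
    rewrite quadG (_ : gap s = \sum_t p t * gap s); last first.
      by rewrite -mulr_suml p_sum1 mul1r.
    rewrite -sumrB mulr_sumr.
    apply: ler_sum => t _; rewrite -mulrBr mulrCA ler_wpM2l//.
    rewrite /gap XS.
    by have := descent (vertices t) (X s); rewrite -/g; lra.
  apply: (@le_trans _ _ ((r * G_norm (G_matrix L p) g) ^+ 2)).
    by rewrite lerXn2r// nnegrE// mulr_ge0// sqrtr_ge0.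
  by rewrite exprMn -mulrA [leRHS]mulrCA ler_wpM2l// sqr_ge0.
pose q j (t : j.-tuple (gpath tau e)) := past_law P draw t.
pose D j := \sum_(t : j.-tuple (gpath tau e)) q j t * gap t.
have D_ge0 j : 0 <= D j.
  apply: sumr_ge0 => t _; rewrite mulr_ge0 ?past_law_ge0// subr_ge0 min_le//.
  exact: (X_ok t).1.
have q_sum1 j : \sum_t q j t = 1 by exact: sum_past_law draws j.
have EgapE j : 'E_P[fun w => gap (past draw j w)]%E = (D j)%:E.
  by rewrite (expectation_past draws (fun t => gap t)).
(* Both sides are expectations of the same random variable, which avoids reindexing sums over
   tuples. *)
have DS j : D j.+1 = \sum_t q j t * \sum_i p i * gap (rcons t i).
  apply: EFin_inj; rewrite -EgapE.
  rewrite -(expectation_past_draw draws (fun t i => gap (rcons t i))).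
  by congr expectation; apply/funext => w; rewrite pastS.
have D_dec j : D j ^+ 2 <= 2 * r ^+ 2 * (D j - D j.+1).
  (* Jensen's inequality for the square: the difference is the variance of the gap. *)
  apply: (@le_trans _ _ (\sum_t q j t * gap t ^+ 2)).
    rewrite -subr_ge0.
    have -> : \sum_t q j t * gap t ^+ 2 - D j ^+ 2 =
        \sum_t q j t * (gap t - D j) ^+ 2.
      rewrite [RHS](eq_bigr (fun t => q j t * gap t ^+ 2
        - 2 * D j * (q j t * gap t) + D j ^+ 2 * q j t)); last first.
        by move=> t _; ring.
      by rewrite big_split/= sumrB -!mulr_sumr q_sum1 -/(D j); ring.
    by apply: sumr_ge0 => t _; rewrite mulr_ge0 ?past_law_ge0 ?sqr_ge0.
  rewrite DS /D -sumrB mulr_sumr; apply: ler_sum => t _.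
  by rewrite -mulrBr [leRHS]mulrCA ler_wpM2l ?past_law_ge0.
have c_ge0 : 0 <= 2 * r ^+ 2 by rewrite mulr_ge0 ?sqr_ge0.
have rate := quadratic_decrease_rate c_ge0 D_ge0 D_dec k.
under eq_fun do rewrite rcd_iterate_past.
rewrite -/X.
have -> : 'E_P[fun w => objective f (X (past draw k w))]%E =
    (D k + optimal_value f)%:E.
  rewrite (expectation_past draws (fun t => objective f (X t))).
  rewrite /D /gap; under [in RHS]eq_bigr do rewrite mulrBr.
  by rewrite sumrB -mulr_suml q_sum1 mul1r subrK.
rewrite sizeE -EFinB addrK -EFin_expe -!EFinM lee_fin.
by rewrite ler_pdivlMr ?ltr0n// mulrC.
Qed.
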